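(* Let $\mathscr C$ be a ribbon category (of modules of a vertex operator algebra), let $J\in\mathscr C$ be a simple current, and let $X\in\mathscr C$ be a fixed point of $J^s$, i.e. $J^s\boxtimes X\cong X$, for some $s\in\mathbb Z_{>0}$. Let $\mathscr P$ be a left ideal of $\mathscr C$ equipped with a modified trace $t_\bullet$ and modified dimension $d(\bullet)$. Let $P\in\mathscr P$ be indecomposable with a finite number of composition factors, such that $d(P)\neq0$ and such that $M_{J,P}\in\operatorname{End}(J\boxtimes P)$ and $\Phi_{J,P}\in\operatorname{End}(P)$ are semisimple endomorphisms. Then one of the following must hold: (1) $\Phi_{X,P}=0$, which in turn implies that $t_P(\Phi_{X,P})=0$. (If $\mathscr C$ is a modular tensor category, then this implies that the corresponding modular S-matrix entry is zero.) (2) $\dim(J)^s\,\bigl(\theta_{J^s\boxtimes P}\circ(\theta_{J^s}^{-1}\boxtimes\theta_P^{-1})\bigr)=1$, where $\theta_{J^s\boxtimes P}\circ(\theta_{J^s}^{-1}\boxtimes\theta_P^{-1})$ is identified with the scalar by which it acts.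
   Context: $\boxtimes$ is the tensor (fusion) product of $\mathscr C$, with unit object the vertex operator algebra. A simple current is an object $J$ with a tensor inverse; $J^s$ is its $s$-fold tensor power. $R$ denotes the braiding, $M_{A,B}=R_{B,A}\circ R_{A,B}\in\operatorname{End}(A\boxtimes B)$ the monodromy, and $\theta$ the categorical twist, satisfying the balancing $\theta_{A\boxtimes B}=M_{A,B}\circ(\theta_A\boxtimes\theta_B)$ (for vertex operator algebras $\theta=e^{2\pi iL_0}$). Let $\operatorname{ptr}^{\mathrm{Left}}$ denote the left partial trace $\operatorname{End}(A\boxtimes B)\to\operatorname{End}(B)$ of the ribbon category. The open Hopf link operator is $\Phi_{A,B}=\operatorname{ptr}^{\mathrm{Left}}(M_{A,B})\in\operatorname{End}(B)$; for fixed $B$, these define a representation of the fusion ring on $\operatorname{End}(B)$, i.e. $\Phi_{A\boxtimes A',B}=\Phi_{A,B}\circ\Phi_{A',B}$. $\dim(A)=\operatorname{tr}(\mathrm{Id}_A)$ is the ordinary categorical dimension. A full subcategory $\mathscr P$ of $\mathscr C$ is a left ideal if for all $Q\in\mathscr P$: $D\boxtimes Q\in\mathscr P$ for all $D\in\mathscr C$; and $D\in\mathscr P$ whenever there is a composition $D\to Q\to D$ equal to the identity. A modified trace on $\mathscr P$ is a family of linear maps $t_Q:\operatorname{End}(Q)\to\mathbb C$, $Q\in\mathscr P$, that is cyclic ($t_Q(fg)=t_{Q'}(gf)$ for $g:Q\to Q'$, $f:Q'\to Q$ in $\mathscr P$) and compatible with partial traces: $t_{D\boxtimes Q}(f)=t_Q(\operatorname{ptr}^{\mathrm{Left}}(f))$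 for $D\in\mathscr C$, $f\in\operatorname{End}(D\boxtimes Q)$. The modified dimension is $d(Q)=t_Q(\mathrm{Id}_Q)$. Every endomorphism of an indecomposable object with finitely many composition factors has a single eigenvalue. *)

(* Defs.v *)
From mathcomp Require Import all_boot all_algebra.
From mathcomp Require Import reals.
From mathcomp Require Import complex.

Set Implicit Arguments.
Unset Strict Implicit.
Unset Printing Implicit Defensive.

Import GRing.Theory.
Local Open Scope ring_scope.

Declare Scope ribbon_scope.
Delimit Scope ribbon_scope with rib.

Reserved Notation "g ∘ f" (at level 40, left associativity).
Reserved Notation "A ⊠ B" (at level 38, left associativity).
Reserved Notation "f ⊗ g" (at level 38, left associativity).
Reserved Notation "J ⊠^ n" (at level 30, right associativity).
Reserved Notation "A ≅ B" (at level 70, no associativity).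

Record linCat (k : fieldType) := LinCat {
  ob :> Type;
  mor : ob -> ob -> lmodType k;
  idm : forall A, mor A A;
  mcomp : forall A B D, mor B D -> mor A B -> mor A D;
  mcomp1m : forall A B (f : mor A B), mcomp (idm B) f = f;
  mcompm1 : forall A B (f : mor A B), mcomp f (idm A) = f;
  mcompA : forall A B D E (h : mor D E) (g : mor B D) (f : mor A B),
    mcomp h (mcomp g f) = mcomp (mcomp h g) f;
  mcomp_linearr : forall A B D (g : mor B D), linear (fun f : mor A B => mcomp g f);
  mcomp_linearl : forall A B D (f : mor A B), linear (fun g : mor B D => mcomp g f)
}.

Arguments mor {k l} A B.
Arguments idm {k l} A.

Notation "g ∘ f" := (mcomp g f) : ribbon_scope.

Local Open Scope ribbon_scope.

Section LinearCategory.
Variables (k : fieldType) (C : linCat k).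
Implicit Types A B D S : C.

Definition mutually_inverse A B (f : mor A B) (g : mor B A) : Prop :=
  g ∘ f = idm A /\ f ∘ g = idm B.

Definition is_iso A B (f : mor A B) : Prop := exists g, mutually_inverse f g.

Definition isomorphic A B : Prop := exists f : mor A B, is_iso f.

Definition is_zero_ob A : Prop := idm A = 0.

Definition is_biproduct A B S (i1 : mor A S) (i2 : mor B S)
    (p1 : mor S A) (p2 : mor S B) : Prop :=
  [/\ p1 ∘ i1 = idm A, p2 ∘ i2 = idm B, p1 ∘ i2 = 0, p2 ∘ i1 = 0
    & i1 ∘ p1 + i2 ∘ p2 = idm S].

Definition indecomposable A : Prop :=
  ~ is_zero_ob A /\
  forall B D (i1 : mor B A) (i2 : mor D A) (p1 : mor A B) (p2 : mor A D),
    is_biproduct i1 i2 p1 p2 -> is_zero_ob B \/ is_zero_ob D.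

Definition monomorphism A B (f : mor A B) : Prop :=
  forall D (g h : mor D A), f ∘ g = f ∘ h -> g = h.

Definition simple_ob S : Prop :=
  ~ is_zero_ob S /\
  forall A (f : mor A S), monomorphism f -> is_zero_ob A \/ is_iso f.

Definition is_kernel A B D (i : mor A B) (p : mor B D) : Prop :=
  p ∘ i = 0 /\
  forall E (f : mor E B), p ∘ f = 0 -> exists! g : mor E A, i ∘ g = f.

Definition is_cokernel A B D (i : mor A B) (p : mor B D) : Prop :=
  p ∘ i = 0 /\
  forall E (f : mor B E), f ∘ i = 0 -> exists! g : mor D E, g ∘ p = f.

Inductive finitely_many_composition_factors : C -> Prop :=
| Composition0 A : is_zero_ob A -> finitely_many_composition_factors A
| CompositionS A B S (i : mor A B) (p : mor B S) :
    is_kernel i p -> is_cokernel i p -> simple_ob S ->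
    finitely_many_composition_factors A -> finitely_many_composition_factors B.

(* Over an algebraically closed field an endomorphism is semisimple iff it is
   diagonalizable: here the object itself is the direct sum of eigenobjects,
   as the eigenspaces of a module endomorphism are submodules. *)
Definition semisimple_endo A (f : mor A A) : Prop :=
  exists (n : nat) (B : 'I_n -> C) (i : forall j, mor (B j) A)
         (p : forall j, mor A (B j)) (c : 'I_n -> k),
    [/\ forall j, p j ∘ i j = idm (B j),
        forall j l, j != l -> p j ∘ i l = 0,
        \sum_(j < n) i j ∘ p j = idm A
      & forall j, f ∘ i j = c j *: i j].

End LinearCategory.

Notation "A ≅ B" := (isomorphic A B) : ribbon_scope.

Record additiveCat (k : fieldType) := AdditiveCat {
  lin_of :> linCat k;
  zero_ob : exists Z : lin_of, is_zero_ob Z;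
  biproduct_ob : forall A B : lin_of, exists (S : lin_of) (i1 : mor A S)
    (i2 : mor B S) (p1 : mor S A) (p2 : mor S B), is_biproduct i1 i2 p1 p2
}.

(* [scal] is the inverse of [c |-> c *: idm uob]: as usual for ribbon categories
   over [k], the endomorphism ring of the unit object is the ground field, which
   is what makes traces and dimensions scalars. *)
Record monoidalCat (k : fieldType) := MonoidalCat {
  add_of :> additiveCat k;
  uob : add_of;
  tens : add_of -> add_of -> add_of;
  tensm : forall (A A' B B' : add_of),
    mor A A' -> mor B B' -> mor (tens A B) (tens A' B');
  assoc : forall A B D : add_of, mor (tens (tens A B) D) (tens A (tens B D));
  assocV : forall A B D : add_of, mor (tens A (tens B D)) (tens (tens A B) D);
  lunit : forall A : add_of, mor (tens uob A) A;
  lunitV : forall A : add_of, mor A (tens uob A);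
  runit : forall A : add_of, mor (tens A uob) A;
  runitV : forall A : add_of, mor A (tens A uob);
  scal : mor uob uob -> k;
  tensm1 : forall A B : add_of, tensm (idm A) (idm B) = idm (tens A B);
  tensm_comp : forall (A A' A'' B B' B'' : add_of)
      (f' : mor A' A'') (f : mor A A') (g' : mor B' B'') (g : mor B B'),
    tensm (f' ∘ f) (g' ∘ g) = tensm f' g' ∘ tensm f g;
  tensm_linearr : forall (A A' B B' : add_of) (f : mor A A'),
    linear (fun g : mor B B' => tensm f g);
  tensm_linearl : forall (A A' B B' : add_of) (g : mor B B'),
    linear (fun f : mor A A' => tensm f g);
  assoc_inv : forall A B D : add_of, mutually_inverse (assoc A B D) (assocV A B D);
  lunit_inv : forall A : add_of, mutually_inverse (lunit A) (lunitV A);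
  runit_inv : forall A : add_of, mutually_inverse (runit A) (runitV A);
  assoc_nat : forall (A A' B B' D D' : add_of)
      (f : mor A A') (g : mor B B') (h : mor D D'),
    assoc A' B' D' ∘ tensm (tensm f g) h = tensm f (tensm g h) ∘ assoc A B D;
  lunit_nat : forall (A A' : add_of) (f : mor A A'),
    lunit A' ∘ tensm (idm uob) f = f ∘ lunit A;
  runit_nat : forall (A A' : add_of) (f : mor A A'),
    runit A' ∘ tensm f (idm uob) = f ∘ runit A;
  pentagon : forall A B D E : add_of,
    assoc A B (tens D E) ∘ assoc (tens A B) D E =
    tensm (idm A) (assoc B D E) ∘ assoc A (tens B D) E ∘ tensm (assoc A B D) (idm E);
  triangle : forall A B : add_of,
    tensm (idm A) (lunit B) ∘ assoc A uob B = tensm (runit A) (idm B);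
  scalK : forall f : mor uob uob, scal f *: idm uob = f;
  scalZ : forall c : k, scal (c *: idm uob) = c
}.

Arguments uob {k m}.
Arguments lunit {k m} A.
Arguments lunitV {k m} A.
Arguments runit {k m} A.
Arguments runitV {k m} A.

Notation "A ⊠ B" := (tens A B) : ribbon_scope.
Notation "f ⊗ g" := (tensm f g) : ribbon_scope.

Record ribbonCat (k : fieldType) := RibbonCat {
  mon_of :> monoidalCat k;
  braid : forall A B : mon_of, mor (A ⊠ B) (B ⊠ A);
  braidV : forall A B : mon_of, mor (B ⊠ A) (A ⊠ B);
  twist : forall A : mon_of, mor A A;
  twistV : forall A : mon_of, mor A A;
  ldual : mon_of -> mon_of;
  ev : forall A : mon_of, mor (ldual A ⊠ A) uob;
  coev : forall A : mon_of, mor uob (A ⊠ ldual A);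
  braid_inv : forall A B : mon_of, mutually_inverse (braid A B) (braidV A B);
  braid_nat : forall (A A' B B' : mon_of) (f : mor A A') (g : mor B B'),
    braid A' B' ∘ (f ⊗ g) = (g ⊗ f) ∘ braid A B;
  hexagon1 : forall A B D : mon_of,
    assoc B D A ∘ braid A (B ⊠ D) ∘ assoc A B D =
    (idm B ⊗ braid A D) ∘ assoc B A D ∘ (braid A B ⊗ idm D);
  hexagon2 : forall A B D : mon_of,
    assocV D A B ∘ braid (A ⊠ B) D ∘ assocV A B D =
    (braid A D ⊗ idm B) ∘ assocV A D B ∘ (idm A ⊗ braid B D);
  zigzag : forall A : mon_of,
    runit A ∘ (idm A ⊗ ev A) ∘ assoc A (ldual A) A ∘ (coev A ⊗ idm A) ∘ lunitV A
    = idm A;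
  zigzag_dual : forall A : mon_of,
    lunit (ldual A) ∘ (ev A ⊗ idm (ldual A)) ∘ assocV (ldual A) A (ldual A)
      ∘ (idm (ldual A) ⊗ coev A) ∘ runitV (ldual A)
    = idm (ldual A);
  twist_inv : forall A : mon_of, mutually_inverse (twist A) (twistV A);
  twist_nat : forall (A B : mon_of) (f : mor A B), twist B ∘ f = f ∘ twist A;
  balancing : forall A B : mon_of,
    twist (A ⊠ B) = braid B A ∘ braid A B ∘ (twist A ⊗ twist B);
  (* [twist (ldual A)] is the transpose of [twist A]. *)
  twist_dual : forall A : mon_of,
    (twist A ⊗ idm (ldual A)) ∘ coev A = (idm A ⊗ twist (ldual A)) ∘ coev A
}.

Section RibbonCategory.
Variables (k : fieldType) (C : ribbonCat k).
Implicit Types A B D J Q X : C.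

Definition monodromy A B : mor (A ⊠ B) (A ⊠ B) := braid B A ∘ braid A B.

(* The coevaluation for which [ldual A] is also a right ldual of [A]. *)
Definition coev' A : mor uob (ldual A ⊠ A) :=
  (idm (ldual A) ⊗ twist A) ∘ braid A (ldual A) ∘ coev A.

Definition ptrL A B (f : mor (A ⊠ B) (A ⊠ B)) : mor B B :=
  lunit B ∘ (ev A ⊗ idm B) ∘ assocV (ldual A) A B ∘ (idm (ldual A) ⊗ f)
    ∘ assoc (ldual A) A B ∘ (coev' A ⊗ idm B) ∘ lunitV B.

Definition trace A (f : mor A A) : k :=
  scal (ev A ∘ (idm (ldual A) ⊗ f) ∘ coev' A).

Definition cdim A : k := trace (idm A).

Definition open_hopf A B : mor B B := ptrL (monodromy A B).

(* In a modular tensor category, the S-matrix entry of [A] and [B], up to the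
   nonzero normalization of the S-matrix. *)
Definition hopf_link A B : k := trace (monodromy A B).

Definition simple_current J : Prop := exists J' : C, J ⊠ J' ≅ uob.

Fixpoint tpow J (n : nat) : C := if n is n'.+1 then J ⊠ tpow J n' else uob.

Definition left_ideal (I : C -> Prop) : Prop :=
  (forall D Q, I Q -> I (D ⊠ Q)) /\
  (forall D Q (r : mor Q D) (i : mor D Q), I Q -> r ∘ i = idm D -> I D).

(* Only the values of [t] at objects of [I] are constrained, and used. *)
Definition modified_trace (I : C -> Prop) (t : forall Q, mor Q Q -> k) : Prop :=
  [/\ forall Q, I Q -> scalar (@t Q),
      forall Q Q' (f : mor Q' Q) (g : mor Q Q'),
        I Q -> I Q' -> t Q (f ∘ g) = t Q' (g ∘ f)
    & forall D Q (f : mor (D ⊠ Q) (D ⊠ Q)), I Q -> t (D ⊠ Q) f = t Q (ptrL f)].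

Definition modified_dim (t : forall Q, mor Q Q -> k) Q : k := t Q (idm Q).

End RibbonCategory.

Notation "J ⊠^ n" := (tpow J n) : ribbon_scope.

(* Main.v *)
(** As [J] is invertible, [J ⊠ P] is indecomposable along with [P], so the
    semisimple monodromy of [J] and [P] is a scalar [c].  By the hexagons
    the monodromy of [J^s] and [P] is then [c ^ s], which by balancing is the
    scalar in (2), and the monodromy of [J ⊠ Y] and [P] is [c] times that of [Y]
    and [P].  Partial traces over a tensor product can be taken one factor at a
    time, hence [Φ_{J ⊠ Y, P} = c dim(J) Φ_{Y, P}], and [J^s ⊠ X ≅ X] gives
    [(c dim(J))^s Φ_{X, P} = Φ_{X, P}]. *)

Require Import Defs.
From mathcomp Require Import all_boot all_algebra.
From mathcomp Require Import reals.
From mathcomp Require Import complex.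

Set Implicit Arguments.
Unset Strict Implicit.
Unset Printing Implicit Defensive.

Import GRing.Theory.
Local Open Scope ring_scope.
Local Open Scope ribbon_scope.

(** Two obstacles shape the proof. The category is not strict, while the braid arguments are only
    manageable without associators; words of objects are therefore replaced by the functors that
    tensor with them, whose composition is strict. Secondly, [ldual (A ⊠ X)] is chosen independently
    of [ldual A] and [ldual X], so a partial trace over [A ⊠ X] does not unfold into two nested
    ones. It has to be shown that a partial trace is the same for every choice of dual, and that the
    twisted coevaluation built from nested cups is itself nested. The second point is where
    balancing enters: the twist of [A ⊠ X] contains exactly the double crossing that nesting the
    cups leaves over. For the scalar [c], idempotents are not assumed to split in the category, so
    the complement of an eigenobject in [J ⊠ P] has to be assembled from the other eigenobjects by
    biproducts. *)

Section LinearFunctions.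
Variables (k : fieldType) (U V : lmodType k) (f : U -> V).
Hypothesis f_lin : linear f.

Lemma linear_zero : f 0 = 0.
Proof. by have := f_lin (-1) 0 0; rewrite scaler0 addr0 scaleN1r addNr. Qed.

Lemma linear_add u v : f (u + v) = f u + f v.
Proof. by have := f_lin 1 u v; rewrite !scale1r. Qed.

Lemma linear_scale a u : f (a *: u) = a *: f u.
Proof. by have := f_lin a u 0; rewrite !addr0 linear_zero addr0. Qed.

Lemma linear_big (I : Type) (r : seq I) (p : pred I) (F : I -> U) :
  f (\sum_(j <- r | p j) F j) = \sum_(j <- r | p j) f (F j).
Proof. exact: (big_morph f linear_add linear_zero). Qed.

End LinearFunctions.

(** * Monoidal categories: linearity, coherence and strictification *)

Section Monoidal.
Context {k : fieldType} {C : monoidalCat k}.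
Implicit Types A B D Z W : C.

Lemma comp0m {A B D} (f : mor A B) : (0 : mor B D) ∘ f = 0.
Proof. exact: (linear_zero (mcomp_linearl f)). Qed.

Lemma compm0 {A B D} (g : mor B D) : g ∘ (0 : mor A B) = 0.
Proof. exact: (linear_zero (mcomp_linearr g)). Qed.

Lemma compDm {A B D} (g h : mor B D) (f : mor A B) : (g + h) ∘ f = g ∘ f + h ∘ f.
Proof. exact: (linear_add (mcomp_linearl f)). Qed.

Lemma compmD {A B D} (g : mor B D) (f h : mor A B) : g ∘ (f + h) = g ∘ f + g ∘ h.
Proof. exact: (linear_add (mcomp_linearr g)). Qed.

Lemma compZm {A B D} a (g : mor B D) (f : mor A B) : (a *: g) ∘ f = a *: (g ∘ f).
Proof. exact: (linear_scale (mcomp_linearl f)). Qed.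

Lemma compmZ {A B D} a (g : mor B D) (f : mor A B) : g ∘ (a *: f) = a *: (g ∘ f).
Proof. exact: (linear_scale (mcomp_linearr g)). Qed.

Lemma comp_suml {A B D} (I : Type) (r : seq I) (p : pred I)
    (F : I -> mor B D) (f : mor A B) :
  (\sum_(j <- r | p j) F j) ∘ f = \sum_(j <- r | p j) F j ∘ f.
Proof. exact: (linear_big (mcomp_linearl f)). Qed.

Lemma comp_sumr {A B D} (I : Type) (r : seq I) (p : pred I)
    (g : mor B D) (F : I -> mor A B) :
  g ∘ (\sum_(j <- r | p j) F j) = \sum_(j <- r | p j) g ∘ F j.
Proof. exact: (linear_big (mcomp_linearr g)). Qed.

Lemma tensm0 {A A' B B'} (f : mor A A') : f ⊗ (0 : mor B B') = 0.
Proof. exact: (linear_zero (tensm_linearr f)). Qed.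

Lemma tensmD {A A' B B'} (f : mor A A') (g h : mor B B') : f ⊗ (g + h) = f ⊗ g + f ⊗ h.
Proof. exact: (linear_add (tensm_linearr f)). Qed.

Lemma tensmZ {A A' B B'} a (f : mor A A') (g : mor B B') : f ⊗ (a *: g) = a *: (f ⊗ g).
Proof. exact: (linear_scale (tensm_linearr f)). Qed.

Lemma tensZm {A A' B B'} a (f : mor A A') (g : mor B B') : (a *: f) ⊗ g = a *: (f ⊗ g).
Proof. exact: (linear_scale (tensm_linearl g)). Qed.

Lemma whisker_comp {A B B' B''} (g : mor B' B'') (f : mor B B') :
  idm A ⊗ (g ∘ f) = (idm A ⊗ g) ∘ (idm A ⊗ f).
Proof. by rewrite -tensm_comp mcomp1m. Qed.

Lemma whiskerr_comp {A B B' B''} (g : mor B' B'') (f : mor B B') :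
  (g ∘ f) ⊗ idm A = (g ⊗ idm A) ∘ (f ⊗ idm A).
Proof. by rewrite -tensm_comp mcomp1m. Qed.

Lemma interchange {A A' B B'} (f : mor A A') (g : mor B B') :
  (f ⊗ idm B') ∘ (idm A ⊗ g) = f ⊗ g.
Proof. by rewrite -tensm_comp mcomp1m mcompm1. Qed.

Lemma interchange' {A A' B B'} (f : mor A A') (g : mor B B') :
  (idm A' ⊗ g) ∘ (f ⊗ idm B) = f ⊗ g.
Proof. by rewrite -tensm_comp mcomp1m mcompm1. Qed.

Lemma assocK A B D : assocV A B D ∘ assoc A B D = idm _.
Proof. by case: (assoc_inv A B D). Qed.
Lemma assocVK A B D : assoc A B D ∘ assocV A B D = idm _.
Proof. by case: (assoc_inv A B D). Qed.
Lemma lunitK A : lunitV A ∘ lunit A = idm _.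
Proof. by case: (lunit_inv A). Qed.
Lemma lunitVK A : lunit A ∘ lunitV A = idm _.
Proof. by case: (lunit_inv A). Qed.
Lemma runitK A : runitV A ∘ runit A = idm _.
Proof. by case: (runit_inv A). Qed.
Lemma runitVK A : runit A ∘ runitV A = idm _.
Proof. by case: (runit_inv A). Qed.

Lemma iso_epi A B D (f : mor A B) (g : mor B A) (x y : mor B D) :
  f ∘ g = idm B -> x ∘ f = y ∘ f -> x = y.
Proof. by move=> fg e; rewrite -(mcompm1 x) -fg mcompA e -mcompA fg mcompm1. Qed.

Lemma iso_mono A B D (f : mor A B) (g : mor B A) (x y : mor D A) :
  g ∘ f = idm A -> f ∘ x = f ∘ y -> x = y.
Proof. by move=> gf e; rewrite -(mcomp1m x) -gf -mcompA e mcompA gf mcomp1m. Qed.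

Lemma assocV_nat {A A' B B' D D' : C} (f : mor A A') (g : mor B B') (h : mor D D') :
  assocV A' B' D' ∘ (f ⊗ (g ⊗ h)) = ((f ⊗ g) ⊗ h) ∘ assocV A B D.
Proof.
apply: (iso_mono (assocK _ _ _)); rewrite !mcompA assocVK assoc_nat.
by rewrite -mcompA assocVK mcomp1m mcompm1.
Qed.

Lemma lunitV_nat {A B} (f : mor A B) : lunitV B ∘ f = (idm uob ⊗ f) ∘ lunitV A.
Proof.
apply: (iso_mono (lunitK _)); rewrite !mcompA lunitVK lunit_nat.
by rewrite -mcompA lunitVK mcomp1m mcompm1.
Qed.

Lemma runitV_nat {A B} (f : mor A B) : runitV B ∘ f = (f ⊗ idm uob) ∘ runitV A.
Proof.
apply: (iso_mono (runitK _)); rewrite !mcompA runitVK runit_nat.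
by rewrite -mcompA runitVK mcomp1m mcompm1.
Qed.

Lemma tens1_faithful {A B} (f g : mor A B) : f ⊗ idm uob = g ⊗ idm uob -> f = g.
Proof.
move=> e; apply: (iso_epi (runitVK _)).
by rewrite -!runit_nat e.
Qed.

Lemma onetens_faithful {A B} (f g : mor A B) :
  idm uob ⊗ f = idm uob ⊗ g -> f = g.
Proof.
move=> e; apply: (iso_epi (lunitVK _)).
by rewrite -!lunit_nat e.
Qed.

(* Kelly's argument: after tensoring with the unit, the pentagon reduces the claim to
   two instances of the triangle. *)
Lemma lunit_tens A B : lunit (A ⊠ B) ∘ assoc uob A B = lunit A ⊗ idm B.
Proof.
apply: onetens_faithful; rewrite whisker_comp.
have K : (assoc uob (uob ⊠ A) B ∘ (assoc uob uob A ⊗ idm B)) ∘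
   ((assocV uob uob A ⊗ idm B) ∘ assocV uob (uob ⊠ A) B) = idm _.
  rewrite mcompA -[X in X ∘ _]mcompA -whiskerr_comp assocVK tensm1.
  by rewrite mcompm1 assocVK.
apply: (iso_epi K); rewrite !mcompA.
rewrite -[_ ∘ (idm uob ⊗ assoc uob A B) ∘ _ ]mcompA.
rewrite -[_ ∘ (_ ∘ _) ∘ (assoc uob uob A ⊗ _)]mcompA -pentagon.
rewrite mcompA triangle -tensm1 -assoc_nat -(triangle uob A) whiskerr_comp.
by rewrite mcompA assoc_nat.
Qed.

(* Strictification: a bracketed word [T] acts on [C] by nested left tensoring, and
   conjugation by the coherence isomorphisms [flatten] turns a morphism between words
   into a natural transformation of these actions.  The actions compose strictly, and
   the associator and unitors become identities. *)
Inductive tree := Leaf of C | Unit | Node of tree & tree.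

Fixpoint tree_ob T : C :=
  match T with Leaf A => A | Unit => uob | Node a b => tree_ob a ⊠ tree_ob b end.

Fixpoint tree_act T Z : C :=
  match T with Leaf A => A ⊠ Z | Unit => Z | Node a b => tree_act a (tree_act b Z) end.

Fixpoint tree_map T Z W (f : mor Z W) : mor (tree_act T Z) (tree_act T W) :=
  match T return mor (tree_act T Z) (tree_act T W) with
  | Leaf A => idm A ⊗ f | Unit => f | Node a b => tree_map a (tree_map b f)
  end.

Fixpoint flatten T Z : mor (tree_ob T ⊠ Z) (tree_act T Z) :=
  match T return mor (tree_ob T ⊠ Z) (tree_act T Z) with
  | Leaf A => idm _ | Unit => lunit Z
  | Node a b => flatten a _ ∘ (idm (tree_ob a) ⊗ flatten b Z) ∘ assoc _ _ _
  end.

Fixpoint flattenV T Z : mor (tree_act T Z) (tree_ob T ⊠ Z) :=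
  match T return mor (tree_act T Z) (tree_ob T ⊠ Z) with
  | Leaf A => idm _ | Unit => lunitV Z
  | Node a b => assocV _ _ _ ∘ (idm (tree_ob a) ⊗ flattenV b Z) ∘ flattenV a _
  end.

Arguments tree_map T {Z W} f.

Lemma tree_map1 T Z : tree_map T (idm Z) = idm _.
Proof. by elim: T Z => [A|//|a IHa b IHb] Z /=; rewrite ?tensm1 // IHb IHa. Qed.

Lemma tree_map_comp T {Z W V : C} (g : mor W V) (f : mor Z W) :
  tree_map T (g ∘ f) = tree_map T g ∘ tree_map T f.
Proof.
elim: T Z W V g f => [A|//|a IHa b IHb] Z W V g f /=; first exact: whisker_comp.
by rewrite IHb IHa.
Qed.

Lemma flattenK T Z : flattenV T Z ∘ flatten T Z = idm _.
Proof.
elim: T Z => [A|//|a IHa b IHb] Z /=; rewrite ?mcomp1m ?lunitK //.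
rewrite !mcompA -[_ ∘ flattenV a _ ∘ flatten a _]mcompA IHa mcompm1.
by rewrite -[_ ∘ _ ∘ (_ ⊗ flatten b _)]mcompA -whisker_comp IHb tensm1 mcompm1 assocK.
Qed.

Lemma flattenVK T Z : flatten T Z ∘ flattenV T Z = idm _.
Proof.
elim: T Z => [A|//|a IHa b IHb] Z /=; rewrite ?mcomp1m ?lunitVK //.
rewrite !mcompA -[_ ∘ assoc _ _ _ ∘ _]mcompA assocVK mcompm1.
by rewrite -[_ ∘ _ ∘ (_ ⊗ flattenV b _)]mcompA -whisker_comp IHb tensm1 mcompm1 IHa.
Qed.

Lemma flatten_nat T {Z W} (f : mor Z W) :
  flatten T W ∘ (idm _ ⊗ f) = tree_map T f ∘ flatten T Z.
Proof.
elim: T Z W f => [A|//|a IHa b IHb] Z W f /=; first by rewrite mcompm1 mcomp1m.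
  by rewrite lunit_nat.
rewrite -!mcompA -tensm1 assoc_nat; rewrite [RHS]mcompA -IHa.
by rewrite mcompA -[in LHS]mcompA (mcompA (_ ⊗ _)) -whisker_comp IHb whisker_comp !mcompA.
Qed.

Lemma flattenV_nat T {Z W} (f : mor Z W) :
  flattenV T W ∘ tree_map T f = (idm _ ⊗ f) ∘ flattenV T Z.
Proof.
apply: (iso_mono (flattenK T W)); rewrite !mcompA flattenVK flatten_nat.
by rewrite -mcompA flattenVK mcomp1m mcompm1.
Qed.

(* Locked, so that rewriting with [mcompA] does not see the composition inside. *)
Fact strict_key : unit. Proof. exact: tt. Qed.

Definition strict a b (f : mor (tree_ob a) (tree_ob b)) Z :
    mor (tree_act a Z) (tree_act b Z) :=
  locked_with strict_key (flatten b Z ∘ (f ⊗ idm Z) ∘ flattenV a Z).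

Arguments strict a b f Z : clear implicits.

Lemma strictE a b (f : mor (tree_ob a) (tree_ob b)) Z :
  strict a b f Z = flatten b Z ∘ (f ⊗ idm Z) ∘ flattenV a Z.
Proof. by rewrite /strict unlock. Qed.

(** The instance at the unit object suffices, since [f ⊗ idm uob] determines [f]. Identities of [C]
    can thus be checked on strict images. *)
Lemma strict_inj a b (f g : mor (tree_ob a) (tree_ob b)) :
  (forall Z, strict a b f Z = strict a b g Z) -> f = g.
Proof.
move=> /(_ uob); rewrite !strictE => e; apply: tens1_faithful.
exact/(iso_mono (flattenK _ _))/(iso_epi (flattenK _ _)).
Qed.

Lemma strict1 a Z : strict a a (idm _) Z = idm _.
Proof. by rewrite !strictE tensm1 mcompm1 flattenVK. Qed.

Lemma strict_comp a b d (g : mor (tree_ob b) (tree_ob d)) (f : mor (tree_ob a) (tree_ob b))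
  Z :
  strict a d (g ∘ f) Z = strict b d g Z ∘ strict a b f Z.
Proof.
rewrite !strictE whiskerr_comp !mcompA -[_ ∘ flattenV b _ ∘ _]mcompA flattenK.
by rewrite mcompm1.
Qed.

Lemma strict_nat a b (f : mor (tree_ob a) (tree_ob b)) Z W (g : mor Z W) :
  strict a b f W ∘ tree_map a g = tree_map b g ∘ strict a b f Z.
Proof.
rewrite !strictE -[LHS]mcompA flattenV_nat !mcompA -[_ ∘ _ ∘ (_ ⊗ g)]mcompA interchange.
by rewrite -interchange' mcompA flatten_nat.
Qed.

(** The tensor product becomes horizontal composition of natural transformations; [flattenV_nat]
    lets the action of [g] slide under that of [f]. *)
Lemma strict_tens a a' b b' (f : mor (tree_ob a) (tree_ob a'))
  (g : mor (tree_ob b) (tree_ob b')) Z :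
  strict (Node a b) (Node a' b') (f ⊗ g) Z = strict a a' f _ ∘ tree_map a (strict b b' g Z).
Proof.
rewrite [strict a a' f _]strictE -[RHS]mcompA flattenV_nat [RHS]mcompA.
rewrite -[X in _ = X ∘ _]mcompA interchange.
have -> : f ⊗ strict b b' g Z =
    (idm _ ⊗ flatten b' Z) ∘ (f ⊗ (g ⊗ idm Z)) ∘ (idm _ ⊗ flattenV b Z).
  by rewrite strictE -!tensm_comp mcomp1m mcompm1.
rewrite !strictE /= !mcompA; do 2 congr (_ ∘ _); rewrite -!mcompA; do 2 congr (_ ∘ _).
by rewrite mcompA assoc_nat -mcompA assocVK mcompm1.
Qed.

(** The two ways of flattening a triple product differ by the associator tensored with [Z]; this is
    the pentagon with [Z] as fourth factor. *)
Lemma strict_assoc a b d Z :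
  strict (Node (Node a b) d) (Node a (Node b d)) (assoc _ _ _) Z = idm _.
Proof.
rewrite !strictE /= -/tree_ob -[RHS](flattenVK (Node (Node a b) d)) /= !mcompA.
do 5 congr (_ ∘ _); rewrite !whisker_comp -!mcompA; do 2 congr (_ ∘ _).
rewrite [X in _ ∘ X]mcompA -pentagon !mcompA; congr (_ ∘ _).
by rewrite -assoc_nat tensm1.
Qed.

Lemma strict_inv a b (f : mor (tree_ob a) (tree_ob b)) (g : mor (tree_ob b) (tree_ob a)) Z :
  f ∘ g = idm _ -> strict a b f Z ∘ strict b a g Z = idm _.
Proof. by move=> fg; rewrite -strict_comp fg strict1. Qed.

Lemma strict_assocV a b d Z :
  strict (Node a (Node b d)) (Node (Node a b) d) (assocV _ _ _) Z = idm _.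
Proof.
by have := @strict_inv (Node (Node a b) d) (Node a (Node b d)) _ _ Z (assocVK _ _ _);
  rewrite strict_assoc mcomp1m.
Qed.

(** Rests on Kelly's identity [lunit_tens], whereas the right unitor needs only the triangle
    axiom. *)
Lemma strict_lunit a Z : strict (Node Unit a) a (lunit _) Z = idm _.
Proof.
rewrite !strictE -lunit_tens /= !mcompA -[_ ∘ assoc _ _ _ ∘ _]mcompA assocVK mcompm1.
rewrite -[_ ∘ _ ∘ (_ ⊗ flattenV a Z)]mcompA lunit_nat mcompA flattenVK mcomp1m.
exact: lunitVK.
Qed.

Lemma strict_lunitV a Z : strict a (Node Unit a) (lunitV _) Z = idm _.
Proof.
by have := @strict_inv (Node Unit a) a _ _ Z (lunitVK _); rewrite strict_lunit mcomp1m.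
Qed.

Lemma strict_runit a Z : strict (Node a Unit) a (runit _) Z = idm _.
Proof.
rewrite !strictE -triangle /= !mcompA -[_ ∘ assoc _ _ _ ∘ _]mcompA assocVK mcompm1.
by rewrite -[_ ∘ _ ∘ (_ ⊗ lunitV Z)]mcompA -whisker_comp lunitVK tensm1 mcompm1 flattenVK.
Qed.

Lemma strict_runitV a Z : strict a (Node a Unit) (runitV _) Z = idm _.
Proof.
by have := @strict_inv (Node a Unit) a _ _ Z (runitVK _); rewrite strict_runit mcomp1m.
Qed.

End Monoidal.

Arguments tree_map {k C} T {Z W} f.
Arguments strict {k C} a b f Z.

(** * Braiding, twist and duality in the strict picture; partial traces over tensor products *)

Section Ribbon.
Context {k : fieldType} {C : ribbonCat k}.
Implicit Types (A B D X Y Z W : C) (a b d x : tree (C := C)).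

Definition strict_braid a b Z :
    mor (tree_act a (tree_act b Z)) (tree_act b (tree_act a Z)) :=
  strict (Node a b) (Node b a) (braid (tree_ob a) (tree_ob b)) Z.

Lemma strict_tens1 a a' b (f : mor (tree_ob a) (tree_ob a')) Z :
  strict (Node a b) (Node a' b) (f ⊗ idm (tree_ob b)) Z = strict a a' f (tree_act b Z).
Proof. by rewrite strict_tens strict1 tree_map1 mcompm1. Qed.

Lemma strict_1tens a b b' (g : mor (tree_ob b) (tree_ob b')) Z :
  strict (Node a b) (Node a b') (idm (tree_ob a) ⊗ g) Z = tree_map a (strict b b' g Z).
Proof. by rewrite strict_tens strict1 mcomp1m. Qed.

Lemma strict_braid_hex1 a b d Z :
  strict_braid a (Node b d) Z =
  tree_map b (strict_braid a d Z) ∘ strict_braid a b (tree_act d Z).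
Proof.
have := congr1 (fun h => strict (Node (Node a b) d) (Node b (Node d a)) h Z)
  (hexagon1 (tree_ob a) (tree_ob b) (tree_ob d)).
rewrite (@strict_comp _ _ _ (Node a (Node b d))) (@strict_comp _ _ _ (Node (Node b d) a)).
rewrite !strict_assoc mcomp1m mcompm1 -/(strict_braid a (Node b d) Z) => ->.
rewrite (@strict_comp _ _ _ (Node (Node b a) d)) (@strict_comp _ _ _ (Node b (Node a d))).
by rewrite strict_assoc mcompm1 strict_tens1 strict_1tens.
Qed.

Lemma strict_braid_hex2 a b d Z :
  strict_braid (Node a b) d Z = strict_braid a d (tree_act b Z) ∘ tree_map a
    (strict_braid b d Z).
Proof.
have := congr1 (fun h => strict (Node a (Node b d)) (Node (Node d a) b) h Z)
  (hexagon2 (tree_ob a) (tree_ob b) (tree_ob d)).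
rewrite (@strict_comp _ _ _ (Node (Node a b) d)) (@strict_comp _ _ _ (Node d (Node a b))).
rewrite !strict_assocV mcomp1m mcompm1 -/(strict_braid (Node a b) d Z) => ->.
rewrite (@strict_comp _ _ _ (Node a (Node d b))) (@strict_comp _ _ _ (Node (Node a d) b)).
by rewrite strict_assocV mcompm1 strict_tens1 strict_1tens.
Qed.

Lemma strict_braid_nat_l a a' b (f : mor (tree_ob a) (tree_ob a')) Z :
  strict_braid a' b Z ∘ strict a a' f (tree_act b Z) =
  tree_map b (strict a a' f Z) ∘ strict_braid a b Z.
Proof.
rewrite -strict_tens1 -strict_1tens /strict_braid
  -(@strict_comp _ _ (Node a b) (Node a' b) (Node b a')).
by rewrite braid_nat (@strict_comp _ _ _ (Node b a)).
Qed.

Lemma strict_braid_nat_r a b b' (g : mor (tree_ob b) (tree_ob b')) Z :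
  strict_braid a b' Z ∘ tree_map a (strict b b' g Z) =
  strict b b' g (tree_act a Z) ∘ strict_braid a b Z.
Proof.
rewrite -strict_tens1 -strict_1tens /strict_braid
  -(@strict_comp _ _ (Node a b) (Node a b') (Node b' a)).
by rewrite braid_nat (@strict_comp _ _ _ (Node b a)).
Qed.

Lemma braidK A B : braidV A B ∘ braid A B = idm _.
Proof. by case: (braid_inv A B). Qed.

Definition strict_braidV a b Z :
    mor (tree_act b (tree_act a Z)) (tree_act a (tree_act b Z)) :=
  strict (Node b a) (Node a b) (braidV (tree_ob a) (tree_ob b)) Z.

Lemma strict_braidK a b Z : strict_braidV a b Z ∘ strict_braid a b Z = idm _.
Proof. exact/(@strict_inv _ _ (Node b a) (Node a b))/braidK. Qed.

(** Naturality along [lunit uob] and the hexagon make this braiding idempotent; being invertible, it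
    is the identity. *)
Lemma strict_braid_unit_r a Z : strict_braid a Unit Z = idm _.
Proof.
have := @strict_braid_nat_r a (Node Unit Unit) Unit (lunit uob) Z.
rewrite strict_braid_hex1 !(@strict_lunit _ _ Unit) tree_map1 mcompm1 mcomp1m /= => e.
by apply: (iso_mono (strict_braidK a Unit Z)); rewrite -e mcompm1.
Qed.

Lemma strict_braid_unit_l b Z : strict_braid Unit b Z = idm _.
Proof.
have := @strict_braid_nat_l (Node Unit Unit) Unit b (lunit uob) Z.
rewrite strict_braid_hex2 !(@strict_lunit _ _ Unit) tree_map1 mcompm1 mcomp1m /= => e.
by apply: (iso_mono (strict_braidK Unit b Z)); rewrite -e mcompm1.
Qed.

(** Naturality of the crossing with [d], applied to the braiding of [a] and [b]. *)
Lemma yang_baxter a b d Z :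
  tree_map d (strict_braid a b Z) ∘ strict_braid a d (tree_act b Z)
    ∘ tree_map a (strict_braid b d Z) =
  strict_braid b d (tree_act a Z) ∘ tree_map b (strict_braid a d Z)
    ∘ strict_braid a b (tree_act d Z).
Proof.
have := @strict_braid_nat_l (Node a b) (Node b a) d (braid _ _) Z.
by rewrite !strict_braid_hex2 -mcompA => <-.
Qed.

(** A strand can be pulled across a cup: by naturality the crossing moves to the unit end of [f],
    where it is trivial. *)
Lemma strand_pass c a b (f : mor uob (tree_ob a ⊠ tree_ob b)) Z :
  tree_map a (strict_braid c b Z) ∘ strict_braid c a (tree_act b Z)
    ∘ tree_map c (strict Unit (Node a b) f Z) =
  strict Unit (Node a b) f (tree_act c Z).
Proof.
rewrite -strict_braid_hex1 (@strict_braid_nat_r c Unit (Node a b)).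
by rewrite strict_braid_unit_r mcompm1.
Qed.

Definition strict_twist a Z : mor (tree_act a Z) (tree_act a Z) :=
  strict a a (twist (tree_ob a)) Z.

Lemma strict_twist_node a b Z :
  strict_twist (Node a b) Z =
  strict_twist a (tree_act b Z) ∘ tree_map a (strict_twist b Z)
    ∘ strict_braid b a Z ∘ strict_braid a b Z.
Proof.
rewrite /strict_twist (balancing (tree_ob a) (tree_ob b)) -mcompA braid_nat mcompA
  braid_nat.
rewrite (@strict_comp _ _ _ (Node b a)) (@strict_comp _ _ _ (Node a b)) strict_tens.
by [].
Qed.

(** The snake of an arbitrary candidate dual [D], so that duals other than [ldual A] can be compared
    with it. [coev_twisted] and [ptr_for] generalize [coev'] and [ptrL] in the same way. *)
Definition zigzag_for A D (e : mor (D ⊠ A) uob) (b : mor uob (A ⊠ D)) : mor A A :=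
  runit A ∘ (idm A ⊗ e) ∘ assoc A D A ∘ (b ⊗ idm A) ∘ lunitV A.

Lemma strict_zigzag a d (e : mor (tree_ob d ⊠ tree_ob a) uob)
  (b : mor uob (tree_ob a ⊠ tree_ob d)) Z :
  strict a a (zigzag_for e b) Z =
  tree_map a (strict (Node d a) Unit e Z) ∘ strict Unit (Node a d) b (tree_act a Z).
Proof.
rewrite /zigzag_for (@strict_comp _ _ _ (Node Unit a)) strict_lunitV mcompm1.
rewrite (@strict_comp _ _ _ (Node (Node a d) a)) (@strict_comp _ _ _ (Node a (Node d a))).
rewrite strict_assoc mcompm1 (@strict_comp _ _ _ (Node a Unit)) strict_runit mcomp1m.
by rewrite (@strict_1tens a (Node d a) Unit) (@strict_tens1 Unit (Node a d)).
Qed.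

Definition coev_twisted A D (b : mor uob (A ⊠ D)) : mor uob (D ⊠ A) :=
  (idm D ⊗ twist A) ∘ braid A D ∘ b.

Lemma strict_coev_twisted a d (b : mor uob (tree_ob a ⊠ tree_ob d)) Z :
  strict Unit (Node d a) (coev_twisted b) Z =
  tree_map d (strict_twist a Z) ∘ strict_braid a d Z ∘ strict Unit (Node a d) b Z.
Proof.
rewrite /coev_twisted (@strict_comp _ _ _ (Node a d)) (@strict_comp _ _ _ (Node d a)).
by rewrite strict_1tens.
Qed.

Definition ptr_for A D B (e : mor (D ⊠ A) uob) (c : mor uob (D ⊠ A))
    (f : mor (A ⊠ B) (A ⊠ B)) : mor B B :=
  lunit B ∘ (e ⊗ idm B) ∘ assocV D A B ∘ (idm D ⊗ f) ∘ assoc D A B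
    ∘ (c ⊗ idm B) ∘ lunitV B.

(** The spectator [B] takes the place of the object acted upon, so a partial trace is a cup and a
    cap around [f] with no associators left. *)
Lemma strict_ptr a d B (e : mor (tree_ob d ⊠ tree_ob a) uob)
  (c : mor uob (tree_ob d ⊠ tree_ob a))
    (f : mor (tree_ob a ⊠ B) (tree_ob a ⊠ B)) :
  ptr_for e c f = strict (Node d a) Unit e B ∘ tree_map d (flatten a B ∘ f ∘ flattenV a B)
                    ∘ strict Unit (Node d a) c B.
Proof.
have -> : tree_map d (flatten a B ∘ f ∘ flattenV a B) =
    flatten d _ ∘ (idm _ ⊗ flatten a B) ∘ (idm _ ⊗ f) ∘ (idm _ ⊗ flattenV a B)
    ∘ flattenV d _.
  rewrite -[LHS]mcompm1 -(flattenVK d) mcompA -flatten_nat; congr (_ ∘ _).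
  by rewrite !whisker_comp !mcompA.
rewrite /ptr_for !strictE /= !mcompA; do 2 congr (_ ∘ _).
rewrite -[_ ∘ flattenV d _ ∘ flatten d _]mcompA flattenK mcompm1.
rewrite -[_ ∘ flattenV d _ ∘ flatten d _]mcompA flattenK mcompm1.
rewrite -[_ ∘ (_ ⊗ flattenV a B) ∘ (_ ⊗ flatten a B)]mcompA -whisker_comp flattenK tensm1
  mcompm1.
rewrite -[_ ∘ (_ ⊗ flattenV a B) ∘ (_ ⊗ flatten a B)]mcompA -whisker_comp flattenK tensm1
  mcompm1.
by [].
Qed.

(* The cup on [x] slides through the strand [a], and Yang-Baxter then moves the
   crossing of [a] and [x] through the cup on [a]; the double crossing contained in the
   twist of [a ⊠ x] cancels what is left. *)
Lemma coev_twisted_nested a x a' x' (ba : mor uob (tree_ob a ⊠ tree_ob a'))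
    (bx : mor uob (tree_ob x ⊠ tree_ob x')) Z :
  tree_map x' (tree_map a' (strict_twist (Node a x) Z))
    ∘ strict_braid (Node a x) (Node x' a') Z
    ∘ (tree_map a (strict Unit (Node x x') bx (tree_act a' Z)) ∘ strict Unit (Node a a') ba Z)
  = tree_map x' (strict Unit (Node a' a) (coev_twisted ba) (tree_act x Z))
    ∘ strict Unit (Node x' x) (coev_twisted bx) Z.
Proof.
pose ca W := strict Unit (Node a' a) (braid (tree_ob a) (tree_ob a') ∘ ba) W.
pose cx W := strict Unit (Node x' x) (braid (tree_ob x) (tree_ob x') ∘ bx) W.
have caE W : strict_braid a a' W ∘ strict Unit (Node a a') ba W = ca W.
  by rewrite /ca (@strict_comp _ _ _ (Node a a')).
have cxE W : strict_braid x x' W ∘ strict Unit (Node x x') bx W = cx W.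
  by rewrite /cx (@strict_comp _ _ _ (Node x x')).
have ca_nat W V (h : mor W V) : ca V ∘ h = tree_map a' (tree_map a h) ∘ ca W.
  exact: (@strict_nat _ _ Unit (Node a' a)).
have cx_nat W V (h : mor W V) : cx V ∘ h = tree_map x' (tree_map x h) ∘ cx W.
  exact: (@strict_nat _ _ Unit (Node x' x)).
rewrite !strict_coev_twisted -!mcompA caE cxE.
have nested : strict_braid (Node a x) (Node x' a') Z
    ∘ (tree_map a (strict Unit (Node x x') bx (tree_act a' Z)) ∘ strict Unit (Node a a') ba Z) =
    tree_map x' (strict_braid a a' (tree_act x Z) ∘ tree_map a (strict_braid x a' Z)) ∘
    (strict_braid a x' (tree_act x (tree_act a' Z)) ∘ (tree_map a (cx (tree_act a' Z))
      ∘ strict Unit (Node a a') ba Z)).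
  rewrite strict_braid_hex1 !strict_braid_hex2 -!mcompA; do 2 congr (_ ∘ _).
  by rewrite mcompA -(tree_map_comp a) cxE.
rewrite nested strict_twist_node.
have shuffle : tree_map a' (strict_braid x a Z ∘ strict_braid a x Z) ∘
    (strict_braid a a' (tree_act x Z) ∘ tree_map a (strict_braid x a' Z)) =
    tree_map a' (strict_braid x a Z) ∘
      (strict_braid x a' (tree_act a Z) ∘ tree_map x (strict_braid a a' Z))
    ∘ strict_braid a x (tree_act a' Z).
  by rewrite (tree_map_comp a') -!mcompA; congr (_ ∘ _); rewrite !mcompA yang_baxter.
have inner : tree_map x' (tree_map a' (strict_braid x a Z ∘ strict_braid a x Z)) ∘
    (tree_map x' (strict_braid a a' (tree_act x Z) ∘ tree_map a (strict_braid x a' Z)) ∘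
    (strict_braid a x' (tree_act x (tree_act a' Z)) ∘ (tree_map a (cx (tree_act a' Z))
      ∘ strict Unit (Node a a') ba Z))) = tree_map x' (ca (tree_act x Z)) ∘ cx Z.
  rewrite mcompA -(tree_map_comp x') shuffle (tree_map_comp x') -mcompA.
  have pass := @strand_pass a x' x (braid _ _ ∘ bx) (tree_act a' Z).
  rewrite (mcompA (strict_braid a x' _)) (mcompA (tree_map x' (strict_braid a x _))).
  rewrite (mcompA (tree_map x' (strict_braid a x _))) [X in _ ∘ (X ∘ _)]pass.
  rewrite -/(cx _) cx_nat [LHS]mcompA -(tree_map_comp x'); congr (tree_map x' _ ∘ _).
  rewrite -!mcompA -(tree_map_comp x) caE mcompA.
  exact: (@strand_pass x a' a).
rewrite -(mcompA (_ ∘ _) (strict_braid x a Z)) (tree_map_comp a') (tree_map_comp x') -mcompA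
  inner.
rewrite mcompA -(tree_map_comp x') (tree_map_comp a') -mcompA -ca_nat.
by rewrite !(tree_map_comp x') -!mcompA.
Qed.

(** Uniqueness of duals: the snake of [D'] gives the statement on caps, that of [D] the statement on
    cups. *)
Lemma duals_comparison A D D' (e : mor (D ⊠ A) uob) (b : mor uob (A ⊠ D))
    (e' : mor (D' ⊠ A) uob) (b' : mor uob (A ⊠ D')) :
  zigzag_for e b = idm A -> zigzag_for e' b' = idm A ->
  exists u : mor D D', e' ∘ (u ⊗ idm A) = e /\ (idm A ⊗ u) ∘ b = b'.
Proof.
move=> zz zz'.
pose a := Leaf A; pose d := Leaf D; pose d' := Leaf D'.
(* The mixed snake: open a cup of the new dual, then close with the cap of the old one. *)
pose u := lunit D' ∘ (e ⊗ idm D') ∘ assocV D A D' ∘ (idm D ⊗ b') ∘ runitV D.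
have semu Z : strict d d' u Z =
    strict (Node d a) Unit e (tree_act d' Z) ∘ tree_map d (strict Unit (Node a d') b' Z).
  rewrite /u (@strict_comp _ _ _ (Node d Unit)) (@strict_runitV _ _ d) mcompm1.
  rewrite (@strict_comp _ _ _ (Node d (Node a d'))) (@strict_1tens d Unit (Node a d')).
  rewrite (@strict_comp _ _ _ (Node (Node d a) d')) (@strict_assocV _ _ d a d') mcompm1.
  rewrite (@strict_comp _ _ _ (Node Unit d')) (@strict_lunit _ _ d') mcomp1m.
  by rewrite (@strict_tens1 (Node d a) Unit).
have zzZ Z : tree_map a (strict (Node d a) Unit e Z)
    ∘ strict Unit (Node a d) b (tree_act a Z) = idm _.
  by rewrite -strict_zigzag zz (@strict1 _ _ a).
have zzZ' Z : tree_map a (strict (Node d' a) Unit e' Z)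
    ∘ strict Unit (Node a d') b' (tree_act a Z) = idm _.
  by rewrite -strict_zigzag zz' (@strict1 _ _ a).
exists u; split.
  apply: (@strict_inj _ _ (Node d a) Unit) => Z.
  rewrite (@strict_comp _ _ _ (Node d' a)) (@strict_tens1 d d' a) semu mcompA.
  have := @strict_nat _ _ (Node d a) Unit e _ _ (strict (Node d' a) Unit e' Z).
  move=> /= <-; rewrite -mcompA -whisker_comp.
  by have /= -> := zzZ' Z; rewrite tensm1 mcompm1.
apply: (@strict_inj _ _ Unit (Node a d')) => Z.
rewrite (@strict_comp _ _ _ (Node a d)) (@strict_1tens a d d') semu (tree_map_comp a).
rewrite -mcompA.
have /= <- := @strict_nat _ _ Unit (Node a d) b _ _ (strict Unit (Node a d') b' Z).
by rewrite mcompA; have /= -> := zzZ (D' ⊠ Z); rewrite mcomp1m.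
Qed.

(** The comparison map [u] runs along the dual strand, which [f] does not touch, so it slides from
    the cup to the cap. *)
Lemma ptr_dual_indep A D D' B (e : mor (D ⊠ A) uob) (b : mor uob (A ⊠ D))
    (e' : mor (D' ⊠ A) uob) (b' : mor uob (A ⊠ D')) (f : mor (A ⊠ B) (A ⊠ B)) :
  zigzag_for e b = idm A -> zigzag_for e' b' = idm A ->
  ptr_for e (coev_twisted b) f = ptr_for e' (coev_twisted b') f.
Proof.
move=> zz zz'; have [u [<- <-]] := duals_comparison zz zz'.
have -> : coev_twisted ((idm A ⊗ u) ∘ b) = (u ⊗ idm A) ∘ coev_twisted b.
  rewrite /coev_twisted !mcompA; congr (_ ∘ _).
  by rewrite -mcompA braid_nat mcompA interchange' interchange.
move: (coev_twisted b) => c.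
rewrite /ptr_for !whiskerr_comp !mcompA; do 2 congr (_ ∘ _).
rewrite -!mcompA; do 2 congr (_ ∘ _).
rewrite assoc_nat !mcompA; congr (_ ∘ _).
by rewrite -assocV_nat -!mcompA tensm1 interchange interchange'.
Qed.

Lemma ptrL_for A B D (e : mor (D ⊠ A) uob) (b : mor uob (A ⊠ D)) (f : mor (A ⊠ B) (A ⊠ B)) :
  zigzag_for e b = idm A -> ptrL f = ptr_for e (coev_twisted b) f.
Proof. exact: (ptr_dual_indep _ (zigzag A)). Qed.

Lemma ptrL_tens A X B (f : mor (A ⊠ X ⊠ B) (A ⊠ X ⊠ B)) :
  ptrL f = ptrL (ptrL (assoc A X B ∘ f ∘ assocV A X B)).
Proof.
pose a := Leaf A; pose x := Leaf X.
pose a' := Leaf (ldual A); pose x' := Leaf (ldual X).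
(* Nested caps and cups exhibit [ldual X ⊠ ldual A] as a dual of [A ⊠ X]. *)
pose e : mor (ldual X ⊠ ldual A ⊠ (A ⊠ X)) uob :=
  ev X ∘ (idm (ldual X) ⊗ (lunit X ∘ (ev A ⊗ idm X) ∘ assocV (ldual A) A X))
    ∘ assoc (ldual X) (ldual A) (A ⊠ X).
pose b : mor uob (A ⊠ X ⊠ (ldual X ⊠ ldual A)) :=
  assocV A X (ldual X ⊠ ldual A)
    ∘ (idm A ⊗ (assoc X (ldual X) (ldual A) ∘ (coev X ⊗ idm (ldual A)) ∘ lunitV (ldual A)))
    ∘ coev A.
pose y := Node a x; pose y' := Node x' a'.
pose epsa Z := strict (Node a' a) Unit (ev A) Z.
pose epsx Z := strict (Node x' x) Unit (ev X) Z.
pose etaa Z := strict Unit (Node a a') (coev A) Z.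
pose etax Z := strict Unit (Node x x') (coev X) Z.
have seme Z : strict (Node y' y) Unit e Z = epsx Z ∘ tree_map x' (epsa (tree_act x Z)).
  rewrite /e (@strict_comp _ _ _ (Node x' (Node a' (Node a x)))).
  rewrite (@strict_assoc _ _ x' a' (Node a x)) mcompm1 (@strict_comp _ _ _ (Node x' x)).
  rewrite (@strict_1tens x' (Node a' (Node a x)) x)
    (@strict_comp _ _ _ (Node (Node a' a) x)).
  rewrite (@strict_assocV _ _ a' a x) mcompm1 (@strict_comp _ _ _ (Node Unit x)).
  by rewrite (@strict_lunit _ _ x) mcomp1m (@strict_tens1 (Node a' a) Unit x).
have semb Z : strict Unit (Node y y') b Z = tree_map a (etax (tree_act a' Z)) ∘ etaa Z.
  rewrite /b (@strict_comp _ _ _ (Node a a')).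
  rewrite (@strict_comp _ _ _ (Node a (Node x y'))).
  rewrite (@strict_assocV _ _ a x y') mcomp1m.
  rewrite (@strict_1tens a a' (Node x y')) (@strict_comp _ _ _ (Node Unit a')).
  rewrite (@strict_lunitV _ _ a') mcompm1 (@strict_comp _ _ _ (Node (Node x x') a')).
  by rewrite (@strict_assoc _ _ x x' a') mcomp1m (@strict_tens1 Unit (Node x x') a').
have zza Z : tree_map a (epsa Z) ∘ etaa (tree_act a Z) = idm _.
  by rewrite -strict_zigzag /zigzag_for (zigzag A) (@strict1 _ _ a).
have zzx Z : tree_map x (epsx Z) ∘ etax (tree_act x Z) = idm _.
  by rewrite -strict_zigzag /zigzag_for (zigzag X) (@strict1 _ _ x).
have zz : zigzag_for e b = idm _.
  apply: (@strict_inj _ _ y y) => Z; rewrite (@strict_zigzag y y') seme semb strict1.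
  rewrite (tree_map_comp y) -mcompA.
  set S := etaa _; set R := etax _; set P := epsx _.
  (* The cap on [A] and the cup on [X] involve disjoint strands, so they can be exchanged; the
     strand of [A] then straightens, and that of [X] afterwards. *)
  have nat : tree_map x (tree_map x' (epsa (tree_act x Z))) ∘ R =
      etax (tree_act x Z) ∘ epsa (tree_act x Z).
    exact/esym/(@strict_nat _ _ Unit (Node x x')).
  have step1 : tree_map y (tree_map x' (epsa (tree_act x Z))) ∘ (tree_map a R ∘ S) =
      tree_map a (etax (tree_act x Z)).
    rewrite mcompA; change (tree_map y ?h) with (tree_map a (tree_map x h)).
    by rewrite -(tree_map_comp a) nat (tree_map_comp a) -mcompA zza mcompm1.
  rewrite step1; change (tree_map y ?h) with (tree_map a (tree_map x h)).
  by rewrite -(tree_map_comp a) zzx (tree_map1 a).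
pose ca Z := strict Unit (Node a' a) (coev' A) Z.
pose cx Z := strict Unit (Node x' x) (coev' X) Z.
have semc Z : strict Unit (Node y' y) (coev_twisted b) Z =
    tree_map x' (ca (tree_act x Z)) ∘ cx Z.
  rewrite (@strict_coev_twisted y y') semb.
  exact: (@coev_twisted_nested a x a' x').
rewrite (ptrL_for f zz) (@strict_ptr y y') seme semc.
rewrite [ptrL (ptrL _)](@strict_ptr x x').
rewrite [ptrL (_ ∘ _)](@strict_ptr a a').
rewrite -/(epsx B) -/(epsa _) -/(ca _) -/(cx _).
have -> : flatten y B ∘ f ∘ flattenV y B = assoc A X B ∘ f ∘ assocV A X B.
  by rewrite /= tensm1 !mcomp1m !mcompm1.
rewrite /= !(mcomp1m, mcompm1) !whisker_comp !mcompA.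
by [].
Qed.

End Ribbon.

(** * Partial traces and open Hopf links, with a scalar monodromy *)

Section OpenHopf.
Context {k : fieldType} {C : ribbonCat k}.
Implicit Types (A B D J P X Y Z : C).

Lemma ptrLZ A B a (f : mor (A ⊠ B) (A ⊠ B)) : ptrL (a *: f) = a *: ptrL f.
Proof. by rewrite /ptrL tensmZ !(compmZ, compZm). Qed.

Lemma ptrL_nat A B B' (h : mor B B') (g : mor B' B) (f : mor (A ⊠ B) (A ⊠ B)) :
  ptrL ((idm A ⊗ h) ∘ f ∘ (idm A ⊗ g)) = h ∘ ptrL f ∘ g.
Proof.
rewrite /ptrL !whisker_comp !mcompA.
rewrite -[_ ∘ (_ ⊗ (_ ⊗ h))]mcompA assocV_nat tensm1 mcompA.
rewrite -[_ ∘ _ ∘ (_ ⊗ h)]mcompA interchange -interchange' mcompA lunit_nat.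
rewrite -!mcompA; do 5 congr (_ ∘ _).
rewrite lunitV_nat !mcompA; congr (_ ∘ _).
by rewrite -assoc_nat tensm1 -!mcompA interchange interchange'.
Qed.

Lemma ptrL_tensl A B (f : mor A A) : ptrL (f ⊗ idm B) = trace f *: idm B.
Proof.
rewrite /ptrL -[_ ∘ assocV _ _ _ ∘ _]mcompA assocV_nat mcompA.
rewrite -[_ ∘ assocV _ _ _ ∘ _]mcompA assocK mcompm1.
rewrite -!(mcompA (lunit B)) -!whiskerr_comp -[ev A ∘ _ ∘ _]scalK tensZm tensm1.
by rewrite compZm mcomp1m compmZ lunitVK.
Qed.

Lemma ptrL_tensr A B (h : mor B B) : ptrL (idm A ⊗ h) = cdim A *: h.
Proof.
have := ptrL_nat h (idm B) (idm A ⊗ idm B).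
by rewrite ptrL_tensl !mcompm1 compmZ tensm1 !mcompm1.
Qed.

(** The trace over [A'] may be computed with [ldual A] as dual of [A'], its cup and cap transported
    along [f] and [g]; these cancel against the conjugation. *)
Lemma ptrL_iso A A' B (f : mor A A') (g : mor A' A) (h : mor (A ⊠ B) (A ⊠ B)) :
  mutually_inverse f g -> ptrL ((f ⊗ idm B) ∘ h ∘ (g ⊗ idm B)) = ptrL h.
Proof.
move=> [gf fg]; pose D := ldual A.
pose e := ev A ∘ (idm D ⊗ g); pose b := (f ⊗ idm D) ∘ coev A.
pose a := Leaf A; pose a' := Leaf A'; pose d := Leaf D.
have zz : zigzag_for e b = idm A'.
  apply: (@strict_inj _ _ a' a') => Z; rewrite (@strict_zigzag _ _ a' d).
  rewrite (@strict_comp _ _ _ (Node d a)) (@strict_1tens _ _ d a' a).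
  rewrite (@strict_comp _ _ _ (Node a d)) (@strict_tens1 _ _ a a' d).
  rewrite mcompA -(@strict_nat _ _ a a') (tree_map_comp a) -!mcompA.
  have := @strict_nat _ _ Unit (Node a d) (coev A) _ _ (strict a' a g Z).
  move=> /= <-; rewrite (mcompA (idm A ⊗ _)).
  have := @strict_zigzag _ _ a d (ev A) (coev A) Z.
  rewrite /zigzag_for zigzag (@strict1 _ _ a) => /esym /= ->.
  by rewrite mcomp1m -(@strict_comp _ _ a' a a') fg.
rewrite (ptrL_for _ zz).
have -> : coev_twisted b = (idm D ⊗ f) ∘ coev' A.
  rewrite /coev_twisted /coev' /b !mcompA; congr (_ ∘ _).
  by rewrite -mcompA braid_nat !mcompA -!whisker_comp twist_nat.
rewrite /ptr_for /ptrL !whiskerr_comp !whisker_comp !mcompA; congr (_ ∘ _).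
rewrite -[_ ∘ _ ∘ assocV _ _ _]mcompA -assocV_nat mcompA.
rewrite -[_ ∘ _ ∘ (_ ⊗ (f ⊗ _))]mcompA -whisker_comp -whiskerr_comp gf !tensm1 mcompm1.
rewrite -[_ ∘ assoc _ _ _ ∘ _]mcompA assoc_nat mcompA.
rewrite -[_ ∘ _ ∘ (_ ⊗ (f ⊗ _))]mcompA -whisker_comp -whiskerr_comp gf !tensm1 mcompm1.
by [].
Qed.

Lemma open_hopf_iso A A' B : A ≅ A' -> open_hopf A B = open_hopf A' B.
Proof.
move=> [f [g fg]]; rewrite /open_hopf -(ptrL_iso _ fg); congr ptrL.
rewrite /monodromy !mcompA -(mcompA _ (braid A B)) braid_nat !mcompA.
by rewrite -[_ ∘ braid B A ∘ _]mcompA braid_nat !mcompA;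
  case: fg => _ fg; rewrite -whiskerr_comp fg tensm1 mcomp1m.
Qed.

(** A full trace is a partial trace with spectator [uob], so [ptrL_tens] applies. This carries the
    vanishing of [open_hopf] over to [hopf_link]. *)
Lemma trace_ptrL A B (f : mor (A ⊠ B) (A ⊠ B)) : trace f = trace (ptrL f).
Proof.
have tr1 D (h : mor D D) : trace h = scal (ptrL (h ⊗ idm uob)).
  by rewrite ptrL_tensl scalZ.
rewrite !tr1 ptrL_tens; congr (scal (ptrL _)).
have runit_tens : (idm A ⊗ runit B) ∘ assoc A B uob = runit (A ⊠ B).
  apply: (@strict_inj _ _ (Node (Node (Leaf A) (Leaf B)) Unit) (Node (Leaf A) (Leaf B))) => Z.
  rewrite (@strict_comp _ _ _ (Node (Leaf A) (Node (Leaf B) Unit))).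
  rewrite strict_assoc mcompm1 (@strict_1tens _ _ (Leaf A) (Node (Leaf B) Unit) (Leaf B)).
  rewrite (@strict_runit _ _ (Leaf B)) (@strict_runit _ _ (Node (Leaf A) (Leaf B))).
  exact: (tree_map1 (Leaf A)).
have -> : assoc A B uob ∘ (f ⊗ idm uob) ∘ assocV A B uob =
    (idm A ⊗ runitV B) ∘ f ∘ (idm A ⊗ runit B).
  apply: (iso_epi (assocVK _ _ _)); apply: (iso_mono (f := idm A ⊗ runit B)
    (g := idm A ⊗ runitV B)); first by rewrite -whisker_comp runitK tensm1.
  rewrite -[_ ∘ assocV _ _ _ ∘ _]mcompA assocK mcompm1 !mcompA.
  rewrite -whisker_comp runitVK tensm1 mcomp1m -[RHS]mcompA runit_tens.
  exact: runit_nat.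
by rewrite ptrL_nat runitV_nat -mcompA runitK mcompm1.
Qed.

Lemma monodromy_unit P : monodromy uob P = idm _.
Proof.
apply: (@strict_inj _ _ (Node Unit (Leaf P)) (Node Unit (Leaf P))) => Z.
rewrite (@strict_comp _ _ _ (Node (Leaf P) Unit)) strict1.
rewrite -[strict _ (Node Unit _) _ Z]/(strict_braid (Leaf P) Unit Z) strict_braid_unit_r
  mcomp1m.
exact: (strict_braid_unit_l (Leaf P)).
Qed.

Lemma monodromy_tens_scalar J Y P c :
  monodromy J P = c *: idm _ ->
  monodromy (J ⊠ Y) P = c *: (assocV J Y P ∘ (idm J ⊗ monodromy Y P) ∘ assoc J Y P).
Proof.
move=> M.
(* In the expanded double crossing, [P] passes [Y], encircles [J] and returns past [Y]; the middle
   factor is the scalar. *)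
have -> : monodromy (J ⊠ Y) P = assocV J Y P ∘ (idm J ⊗ braid P Y) ∘ assoc J P Y
    ∘ (monodromy J P ⊗ idm Y) ∘ assocV J P Y ∘ (idm J ⊗ braid Y P) ∘ assoc J Y P.
  pose j := Leaf J; pose y := Leaf Y; pose p := Leaf P.
  apply: (@strict_inj _ _ (Node (Node j y) p) (Node (Node j y) p)) => Z.
  rewrite (@strict_comp _ _ _ (Node p (Node j y))).
  rewrite -[strict (Node p _) _ _ Z]/(strict_braid p (Node j y) Z).
  rewrite -[strict _ (Node p _) _ Z]/(strict_braid (Node j y) p Z).
  rewrite strict_braid_hex1 strict_braid_hex2.
  rewrite (@strict_comp _ _ _ (Node j (Node y p))) strict_assoc mcompm1.
  rewrite (@strict_comp _ _ _ (Node j (Node p y)))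
    (@strict_1tens _ _ j (Node y p) (Node p y)).
  rewrite (@strict_comp _ _ _ (Node (Node j p) y)) (@strict_assocV _ _ j p y) mcompm1.
  rewrite (@strict_comp _ _ _ (Node (Node j p) y))
    (@strict_tens1 _ _ (Node j p) (Node j p) y).
  rewrite (@strict_comp _ _ _ (Node j (Node p y))) (@strict_assoc _ _ j p y) mcompm1.
  rewrite (@strict_comp _ _ _ (Node j (Node y p))) (@strict_assocV _ _ j y p) mcomp1m.
  rewrite (@strict_1tens _ _ j (Node p y) (Node y p)).
  by rewrite (@strict_comp _ _ _ (Node p j)) !mcompA.
rewrite M tensZm tensm1 !(compmZ, compZm) mcompm1; congr (_ *: _).
rewrite -[_ ∘ assoc _ _ _ ∘ _]mcompA assocVK mcompm1 -[_ ∘ (_ ⊗ braid P Y) ∘ _]mcompA.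
by rewrite -whisker_comp.
Qed.

(** Once [c] is pulled out, [J] is a closed loop linked with nothing, and it contributes
    [cdim J]. *)
Lemma open_hopf_tens_scalar J Y P c :
  monodromy J P = c *: idm _ ->
  open_hopf (J ⊠ Y) P = (cdim J * c) *: open_hopf Y P.
Proof.
move=> M; rewrite {1}/open_hopf (monodromy_tens_scalar _ M) ptrLZ ptrL_tens !mcompA.
rewrite assocVK mcomp1m -mcompA assocVK mcompm1 ptrL_tensr ptrLZ scalerA.
by rewrite mulrC.
Qed.

Lemma monodromy_tpow J P c n :
  monodromy J P = c *: idm _ -> monodromy (J ⊠^ n) P = c ^+ n *: idm _.
Proof.
move=> M; elim: n => [|n IH] /=; first by rewrite monodromy_unit scale1r.
rewrite (monodromy_tens_scalar _ M) IH tensmZ tensm1 !(compmZ, compZm) mcompm1 assocK.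
by rewrite scalerA exprS.
Qed.

Lemma open_hopf_tpow J X P c n :
  monodromy J P = c *: idm _ ->
  open_hopf (J ⊠^ n ⊠ X) P = (cdim J * c) ^+ n *: open_hopf X P.
Proof.
move=> M; elim: n => [|n IH] /=.
  rewrite scale1r; apply: open_hopf_iso; exists (lunit X), (lunitV X).
  exact: lunit_inv.
rewrite exprS -scalerA -IH -(open_hopf_tens_scalar _ M); apply: open_hopf_iso.
by exists (assoc _ _ _), (assocV _ _ _); apply: assoc_inv.
Qed.

Lemma twist_monodromy A B :
  twist (A ⊠ B) ∘ (twistV A ⊗ twistV B) = monodromy A B.
Proof.
rewrite balancing -mcompA -tensm_comp.
by case: (twist_inv A) (twist_inv B) => _ -> [_ ->]; rewrite tensm1 mcompm1.
Qed.

End OpenHopf.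

(** * Semisimple endomorphisms of indecomposable objects, and tensoring with an invertible object *)

Section Indecomposable.
Context {k : fieldType} {C : monoidalCat k}.
Implicit Types A B D J P Q S : C.

Lemma zero_ob_retract A B (i : mor B A) (r : mor A B) :
  r ∘ i = idm B -> is_zero_ob A -> is_zero_ob B.
Proof. by rewrite /is_zero_ob => <- A0; rewrite -(mcomp1m i) A0 comp0m compm0. Qed.

(** The splitting object is the iterated biproduct of the [B j], starting from a zero object for the
    empty sum. *)
Lemma sum_idempotents_split Q n (B : 'I_n -> C) (i : forall j, mor (B j) Q)
    (p : forall j, mor Q (B j)) (r : seq 'I_n) :
  (forall j, p j ∘ i j = idm (B j)) -> (forall j l, j != l -> p j ∘ i l = 0) ->
  uniq r ->
  exists (S : C) (i' : mor S Q) (p' : mor Q S),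
    p' ∘ i' = idm S /\ i' ∘ p' = \sum_(j <- r) i j ∘ p j.
Proof.
move=> pi ort; elim: r => [_|j r IH /= /andP[jr r_uniq]].
  have [Z Z0] := zero_ob C; exists Z, 0, 0.
  by rewrite comp0m Z0 big_nil compm0.
have [S [i' [p' [p'i' i'p']]]] := IH r_uniq.
have sum0 : p j ∘ (\sum_(l <- r) i l ∘ p l) = 0 /\ (\sum_(l <- r) i l ∘ p l) ∘ i j = 0.
  split; rewrite ?comp_sumr ?comp_suml big_seq big1 // => l lr.
    by rewrite mcompA ort ?comp0m //; apply: contraNneq jr => ->.
  by rewrite -mcompA ort ?compm0 //; apply: contraNneq jr => <-.
(* Inserting [p' ∘ i' = idm S] turns [i'] into the partial sum followed by nothing but itself, and
   [p j] kills that sum. *)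
have pji' : p j ∘ i' = 0.
  by rewrite -(mcompm1 i') -p'i' (mcompA i') mcompA i'p' sum0.1 comp0m.
have p'ij : p' ∘ i j = 0.
  by rewrite -(mcomp1m p') -p'i' -!mcompA (mcompA i') i'p' sum0.2 compm0.
have [T [i1 [i2 [p1 [p2 [p1i1 p2i2 p1i2 p2i1 sumT]]]]]] := biproduct_ob (B j) S.
exists T, (i j ∘ p1 + i' ∘ p2), (i1 ∘ p j + i2 ∘ p').
rewrite !(compDm, compmD) big_cons -i'p' !mcompA.
rewrite -(mcompA i1 (p j) (i j)) pi -(mcompA i2 p' (i j)) p'ij.
rewrite -(mcompA i1 (p j) i') pji' -(mcompA i2 p' i') p'i'.
rewrite -(mcompA (i j) p1 i1) p1i1 -(mcompA i' p2 i1) p2i1.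
rewrite -(mcompA (i j) p1 i2) p1i2 -(mcompA i' p2 i2) p2i2.
by rewrite !(mcompm1, compm0, comp0m) !(addr0, add0r) sumT.
Qed.

(** A nonzero eigenobject has a zero complement, so it exhausts [Q] and its eigenvalue is the
    scalar. *)
Lemma semisimple_endo_scalar Q (f : mor Q Q) :
  (forall B D (i1 : mor B Q) (i2 : mor D Q) (p1 : mor Q B) (p2 : mor Q D),
    is_biproduct i1 i2 p1 p2 -> is_zero_ob B \/ is_zero_ob D) ->
  semisimple_endo f -> exists c, f = c *: idm Q.
Proof.
move=> indec [n [B [i [p [c [pi ort sum1 eig]]]]]].
(* If every eigenobject is zero then so is [Q], and the scalar 0 will do. *)
case: (pickP (fun j => idm (B j) != 0)) => [j Bj|B0]; last first.
  exists 0; rewrite scale0r -(mcompm1 f) -sum1 comp_sumr big1 // => j _.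
  by rewrite -(mcompm1 (i j)); move/negbFE/eqP: (B0 j) => ->; rewrite compm0 comp0m compm0.
have [S [i' [p' [p'i' i'p']]]] :=
  sum_idempotents_split pi ort (filter_uniq (predC1 j) (index_enum_uniq _)).
rewrite big_filter in i'p'.
have pji' : p j ∘ i' = 0.
  rewrite -(mcompm1 i') -p'i' (mcompA i') mcompA i'p' comp_sumr big1 ?comp0m // => l lj.
  by rewrite mcompA ort ?comp0m // eq_sym.
have p'ij : p' ∘ i j = 0.
  rewrite -(mcomp1m p') -p'i' -!mcompA (mcompA i') i'p' comp_suml big1 ?compm0 // => l lj.
  by rewrite -mcompA ort ?compm0.
have sumS : i j ∘ p j + i' ∘ p' = idm Q by rewrite i'p' -sum1 [RHS](bigD1 j).
case: (indec (B j) S (i j) i' (p j) p') => [|/eqP|S0]; first by split.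
  by rewrite (negPf Bj).
exists (c j); rewrite -(mcompm1 f) -sumS -(mcompm1 i') S0 compm0 comp0m addr0.
by rewrite mcompA eig compZm.
Qed.

Lemma isomorphic_sym A B : A ≅ B -> B ≅ A.
Proof. by move=> [f [g [gf fg]]]; exists g, f. Qed.

Lemma isomorphic_trans A B D : A ≅ B -> B ≅ D -> A ≅ D.
Proof.
move=> [f [g [gf fg]]] [f' [g' [gf' fg']]]; exists (f' ∘ f), (g ∘ g'); split.
  by rewrite mcompA -(mcompA g) gf' mcompm1.
by rewrite mcompA -(mcompA f') fg mcompm1.
Qed.

Lemma tensor_inverse_cancel J J' B : J ⊠ J' ≅ uob -> J ⊠ (J' ⊠ B) ≅ B.
Proof.
move=> [f [g [gf fg]]]; apply: (@isomorphic_trans _ (J ⊠ J' ⊠ B)).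
  by apply: isomorphic_sym; exists (assoc _ _ _), (assocV _ _ _); apply: assoc_inv.
apply: (@isomorphic_trans _ (uob ⊠ B)).
  by exists (f ⊗ idm B), (g ⊗ idm B); split; rewrite -whiskerr_comp ?gf ?fg tensm1.
by exists (lunit B), (lunitV B); apply: lunit_inv.
Qed.

(** Tensoring with [J'] turns a decomposition of [J ⊠ P] into one of [P], and tensoring back with
    [J] shows that no nonzero summand has become zero. *)
Lemma invertible_tens_indecomposable J J' P B D (i1 : mor B (J ⊠ P)) (i2 : mor D (J ⊠ P))
    (p1 : mor (J ⊠ P) B) (p2 : mor (J ⊠ P) D) :
  J ⊠ J' ≅ uob -> J' ⊠ J ≅ uob -> indecomposable P ->
  is_biproduct i1 i2 p1 p2 -> is_zero_ob B \/ is_zero_ob D.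
Proof.
move=> JJ' J'J [_ indec] [p1i1 p2i2 p1i2 p2i1 sum1].
have reflect0 E : is_zero_ob (J' ⊠ E) -> is_zero_ob E.
  have [f [g [_ fg]]] := tensor_inverse_cancel E JJ' => E0.
  by apply: (zero_ob_retract fg); rewrite /is_zero_ob -tensm1 E0 tensm0.
have [f [g [gf fg]]] := tensor_inverse_cancel P J'J.
have biprod : is_biproduct (f ∘ (idm J' ⊗ i1)) (f ∘ (idm J' ⊗ i2))
    ((idm J' ⊗ p1) ∘ g) ((idm J' ⊗ p2) ∘ g).
  split; rewrite ?mcompA -?(mcompA _ g f) ?gf ?mcompm1 -?whisker_comp;
    rewrite ?p1i1 ?p2i2 ?p1i2 ?p2i1 ?tensm1 ?tensm0 //.
  rewrite -!(mcompA f) -!whisker_comp -compmD -compDm -tensmD sum1 tensm1.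
  by rewrite mcomp1m fg.
by case: (indec _ _ _ _ _ _ biprod) => /reflect0; [left | right].
Qed.

End Indecomposable.

Theorem proposition3p10 (R : realType) (C : ribbonCat R[i])
    (J X : C) (s : nat) (I : C -> Prop) (t : forall Q : C, mor Q Q -> R[i]) (P : C)
    (hJ : simple_current J)
    (hs : (0 < s)%N)
    (hX : J ⊠^ s ⊠ X ≅ X)
    (hI : left_ideal I)
    (ht : modified_trace I t)
    (hP : I P)
    (hPindec : indecomposable P)
    (hPfin : finitely_many_composition_factors P)
    (hdP : modified_dim t P <> 0)
    (hM : semisimple_endo (monodromy J P))
    (hPhi : semisimple_endo (open_hopf J P)) :
  (open_hopf X P = 0 /\ t P (open_hopf X P) = 0 /\ hopf_link X P = 0) \/
  (exists c : R[i],
      twist (J ⊠^ s ⊠ P) ∘ (twistV (J ⊠^ s) ⊗ twistV P) = c *: idm (J ⊠^ s ⊠ P) /\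
      cdim J ^+ s * c = 1).
Proof.
have [J' JJ'] := hJ.
(* [simple_current] gives only a right inverse; the braiding makes it two-sided. *)
have J'J : J' ⊠ J ≅ uob.
  apply: isomorphic_trans JJ'; exists (braid J' J), (braidV J' J).
  exact: braid_inv.
have [c Mc] := semisimple_endo_scalar
  (fun B D i1 i2 p1 p2 => invertible_tens_indecomposable JJ' J'J hPindec) hM.
have fix_eq : (cdim J * c) ^+ s *: open_hopf X P = open_hopf X P.
  by rewrite -(open_hopf_tpow X s Mc); apply: open_hopf_iso.
have [Phi0|/eqP Phi_neq0] := eqVneq (open_hopf X P) 0; [left|right].
  have [t_lin _ _] := ht; rewrite Phi0; split=> //; split.
    by have := t_lin P hP (-1) 0 0; rewrite scaler0 addr0 mulN1r addNr.
  rewrite /hopf_link trace_ptrL -/(open_hopf X P) Phi0 /trace.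
  rewrite tensm0 compm0 comp0m.
  (* [scal] sends 0 to 0 because it inverts [c |-> c *: idm uob]. *)
  by rewrite -(scale0r (idm uob)) scalZ.
exists (c ^+ s); rewrite twist_monodromy (monodromy_tpow s Mc); split=> //.
apply/eqP; rewrite -exprMn -subr_eq0; apply/eqP.
(* The scalar [(cdim J * c) ^+ s - 1] annihilates a nonzero vector, so it vanishes. *)
move/eqP: fix_eq; rewrite -subr_eq0 -{2}(scale1r (open_hopf X P)) -scalerBl.
by rewrite scaler_eq0 => /orP[/eqP//|/eqP].
Qed.
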